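(* The cardinal $\mathfrak{i}_a$ (the minimum size of an anchored independent family $\mathcal{A}\subseteq\mathcal{P}(\omega)$ which separates points) is equal to the minimum cardinal $\kappa$ for which there is a countable, dense subspace of $2^\kappa$ (with the product topology, $2=\{0,1\}$ discrete) which is submaximal.
   Context: All topological spaces are assumed Hausdorff and crowded (i.e. without isolated points). A space $X$ is submaximal if every dense subset $D\subseteq X$ is open in $X$. For a set $\mathcal{X}$, $FF(\mathcal{X})$ denotes the set of all finite partial functions $p:\mathcal{X}\to 2$. For $A\subseteq\omega$ let $A^0=A$ and $A^1=\omega\setminus A$. For $\mathcal{A}\subseteq\mathcal{P}(\omega)$ and $h\in FF(\mathcal{A})$ let $\mathcal{A}^h=\bigcap_{A\in \mathrm{dom}(h)}A^{h(A)}$ (with $\mathcal{A}^\emptyset=\omega$). The family $\mathcal{A}$ is independent if $\mathcal{A}^h$ is infinite for every $h\in FF(\mathcal{A})$. An independent family $\mathcal{A}$ separates points if for all $n\neq m$ in $\omega$ there is $A\in\mathcal{A}$ such that either $n\in A$ and $m\notin A$, or $n\notin A$ and $m\in A$. A set $X\subseteq\omega$ is $\mathcal{A}$-dense if $X\cap\mathcal{A}^h$ is infinite for every $h\in FF(\mathcal{A})$. An independent family $\mathcal{A}$ is an anchored independent family if for every $\mathcal{A}$-dense set $X$ and every $n\in X$ there exists $h\in FF(\mathcal{A})$ such that $n\in\mathcal{A}^h\subseteq^* X$, where $Y\subseteq^* X$ means that $Y\setminus X$ is finite. The cardinal $\mathfrak{i}_a$ is the minimum size of an anchored independent family which separates points.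 *)

(* Defs.v *)
From mathcomp Require Import all_boot finmap.
From mathcomp Require Import all_classical topology separation_axioms.
From mathcomp Require Import function_spaces.

Set Implicit Arguments.
Unset Strict Implicit.
Unset Printing Implicit Defensive.

Local Open Scope classical_set_scope.
Local Open Scope card_scope.

(* A finite partial function from [A] to [2] is a finite map on [set nat] whose
   domain is included in [A]; the value [false] stands for 0, [true] for 1. *)
Definition FF (A : set (set nat)) : set {fmap set nat -> bool} :=
  [set h | [set` domf h] `<=` A].

(* [B^0 = B] and [B^1 = nat \ B]. *)
Definition signed_set (B : set nat) (b : bool) : set nat :=
  if b then ~` B else B.

(* The intersection of the [B^(h B)] for [B] in the domain of [h]; it is
   [setT] when [h] is empty. *)
Definition bool_comb (h : {fmap set nat -> bool}) : set nat :=
  [set n | forall (B : set nat) (b : bool), h.[? B]%fmap = Some b ->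
    signed_set B b n].

Definition independent (A : set (set nat)) : Prop :=
  forall h, FF A h -> infinite_set (bool_comb h).

Definition separates_points (A : set (set nat)) : Prop :=
  forall n m : nat, n <> m ->
    exists2 B, A B & (B n /\ ~ B m) \/ (~ B n /\ B m).

Definition family_dense (A : set (set nat)) (X : set nat) : Prop :=
  forall h, FF A h -> infinite_set (X `&` bool_comb h).

Definition almost_subset (Y X : set nat) : Prop := finite_set (Y `\` X).

Definition anchored_independent (A : set (set nat)) : Prop :=
  independent A /\
  forall X, family_dense A X -> forall n, X n ->
    exists h, [/\ FF A h, bool_comb h n & almost_subset (bool_comb h) X].

Definition crowded (T : topologicalType) : Prop := isolated [set: T] = set0.

Definition submaximal (T : topologicalType) : Prop :=
  forall D : set T, dense D -> open D.

(* Cardinals are represented by types compared with [#<=], so [K] stands for the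
   least cardinal satisfying [P]; it is unique up to equinumerosity. *)
Definition least_cardinal (P : Type -> Prop) (K : Type) : Prop :=
  P K /\ forall L : Type, P L -> [set: K] #<= [set: L].

Definition is_i_a : Type -> Prop :=
  least_cardinal (fun K => exists A : set (set nat),
    [/\ anchored_independent A, separates_points A & A #= [set: K]]).

(* [{ptws K -> bool}] is the product [2^K], and [D] seen as a type carries the
   subspace topology. The conjuncts [hausdorff_space] and [crowded] express the
   convention that every space is Hausdorff and without isolated points. *)
Definition has_countable_dense_submaximal (K : Type) : Prop :=
  exists D : set {ptws K -> bool},
    [/\ countable D, dense D, hausdorff_space D, crowded D & submaximal D].

(* Main.v *)
From mathcomp Require Import all_boot finmap.
From mathcomp Require Import all_classical topology separation_axioms.
From mathcomp Require Import function_spaces.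
Require Import Defs.

Set Implicit Arguments.
Unset Strict Implicit.
Unset Printing Implicit Defensive.

Local Open Scope classical_set_scope.
Local Open Scope card_scope.

(** Write a family [A = {A_k | k in K}] of subsets of [nat] as a sequence of
    points of the cube [2^K], the [n]-th point having [k]-th coordinate 0 exactly
    when [n] is in [A_k]. The Boolean combinations of [A] are then the traces on
    the sequence of the basic open boxes of the cube, so that
    - [A] is independent iff every box contains infinitely many terms, that is,
      iff the set of points is dense in [2^K] and has no isolated points;
    - [A] separates points iff the sequence is injective;
    - [X] is [A]-dense iff [X] names a dense subset of the set of points;
    - the anchoring condition says that a dense set is a neighbourhood of each
      of its points. The finite error that it allows is harmless: a Hausdorff
      box around a point can be shrunk to avoid finitely many other points.
    Hence an anchored independent family of size [K] that separates points is the
    same thing as a countable dense submaximal subspace of [2^K]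
    ([anchored_family_points], [submaximal_points_subspace],
    [subspace_submaximal_points]). A countable dense crowded subspace is infinite,
    so it can be enumerated by [nat] without repetition.

    The two minima are therefore minima of the same class of cardinals. It remains
    to see that this class has a least element. Least elements of nonempty classes
    of sets of subsets exist by [exists_least_card]: a maximal set of simultaneous
    injections must exhaust one of the sets.

    That the class is nonempty is [exists_submaximal_points]. Start from an
    independent family [A_(N, n)] indexed by all pairs of a subset [N] of [nat]
    and a number [n], and from an ideal [J] on [nat], maximal among those that
    contain no Boolean combination of the family, not even up to finitely many
    points. When [N] is in [J] and [n] is not in [N], replace
    [A_(N, n)] by [(A_(N, n) \ N) u {n}]. Modulo [J] nothing has changed, so the
    family is still independent. The new sets separate each [n] from each set of
    [J] that does not contain it, in particular from each other point. Finally, by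
    maximality of [J], a set [X] that is dense for the new family has its
    complement [N] in [J], so for [n] in [X] the new set of index [(N, n)] contains
    [n] and is included in [X]. *)

(** * Sequences of points of a cube and boxes *)

(** The trace on the family [p] of the basic open set of [2^K] around [x] that
    fixes the coordinates in [S]. Using a centre [x] and a set of coordinates,
    instead of a finite partial function, rules out inconsistent conditions and
    makes sense for an arbitrary type [K]. *)
Definition box (I K : Type) (p : I -> K -> bool) (x : K -> bool) (S : set K) :
  set I := [set n | forall k, S k -> p n k = x k].

(** When [p] is injective and its range has no isolated points, this is density of
    [p @` X] in [2^K]. Asking for infinite intersections makes [inf_dense p setT]
    say, for an injective [p], both that the range is dense and that it is crowded. *)
Definition inf_dense (I K : Type) (p : I -> K -> bool) (X : set I) : Prop :=
  forall x S, finite_set S -> infinite_set (X `&` box p x S).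

(** The common form of the two sides of the equality: the points [p n] are
    pairwise distinct and form a dense, crowded and submaximal subspace. *)
Definition submaximal_points (I K : Type) (p : I -> K -> bool) : Prop :=
  [/\ inf_dense p setT, injective p
    & forall X, inf_dense p X -> forall n, X n ->
        exists2 S, finite_set S & box p (p n) S `<=` X].

Section Boxes.
Variables (I K : Type) (p : I -> K -> bool).

Lemma box_center x S n : box p x S n -> box p (p n) S = box p x S.
Proof.
by move=> xn; apply/seteqP; split=> m mS k Sk; rewrite mS// xn.
Qed.

Lemma boxU x S S' : box p x (S `|` S') = box p x S `&` box p x S'.
Proof.
apply/seteqP; split=> [m mS|m [mS mS'] k [|]]; [|exact: mS|exact: mS'].
by split=> k ?; apply: mS; [left|right].
Qed.

Lemma box0 x : box p x set0 = setT.
Proof. by apply/seteqP; split=> // m _ k []. Qed.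

(** The cube is T1: finitely many points are excluded by fixing, for each of them,
    one more coordinate. *)
Lemma separate_finite n (F : set I) : injective p -> finite_set F -> ~ F n ->
  exists2 S, finite_set S & box p (p n) S `<=` ~` F.
Proof.
move=> pI finF nF.
have [g gP] : {g : I -> set K & forall m, finite_set (g m) /\
    (F m -> ~ box p (p n) (g m) m)}.
  apply: (@choice _ _ (fun m S => finite_set S /\ (F m -> ~ box p (p n) S m))).
  move=> m; have [Fm|nFm] := pselect (F m); last by exists set0; split.
  have /existsNP[k mk] : ~ forall k, p m k = p n k.
    by move=> mn; apply: nF; rewrite -(pI _ _ (funext mn)).
  by exists [set k]; split=> [|_ /(_ k erefl)//]; exact: finite_set1.
exists (\bigcup_(m in F) g m).
  by apply: bigcup_finite => // m _; exact: (gP m).1.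
by move=> m mS Fm; apply: (gP m).2 => // k gk; apply: mS; exists m.
Qed.
End Boxes.

(** * A large independent family *)

(** A finite set involves finitely many pairs, so the largest of the ranks from
    which these pairs are told apart works for all of them. *)
Lemma eventually_injective (K : Type) (C : eqType) (r : nat -> K -> C)
    (S : set K) :
  (forall k l, k <> l ->
    exists i0, forall i, (i0 <= i)%N -> r i k <> r i l) ->
  finite_set S ->
  exists i0, forall i, (i0 <= i)%N -> {in S &, injective (r i)}.
Proof.
move=> rP finS.
have [d dP] : {d : K * K -> nat & forall kl, kl.1 <> kl.2 ->
    forall i, (d kl <= i)%N -> r i kl.1 <> r i kl.2}.
  apply: (@choice _ _ (fun kl i0 => kl.1 <> kl.2 ->
    forall i, (i0 <= i)%N -> r i kl.1 <> r i kl.2)) => -[k l] /=.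
  have [->|/rP[i0 ?]] := pselect (k = l); first by exists 0.
  by exists i0.
have /finite_seqP[s sE] : finite_set (d @` (S `*` S)).
  exact/finite_image/finite_setX.
exists (\max_(i <- s) i) => i si k l /set_mem Sk /set_mem Sl rkl.
apply: contrapT => kl; apply: (dP (k, l) kl i) => //; apply: leq_trans si.
apply: (@leq_bigmax_seq _ _ xpredT id) => //.
by have : (d @` (S `*` S)) (d (k, l)) by [exists (k, l)]; rewrite sE.
Qed.

(** The independent family of Fichtenholz, Kantorovich and Hausdorff: [k] gives the
    set of codes of the pairs [(i, l)] such that the [i]-th approximation [r i k]
    of [k] is listed in [l]. *)
Definition code_points (K : Type) (C : countType) (r : nat -> K -> C)
    (n : nat) (k : K) : bool :=
  if choice.unpickle n is Some (i, l) then r i k \notin (l : seq C) else true.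

(** For [i] large the approximations [r i k], [k] in [S], are distinct, so the list
    of those with [x k = false] satisfies all the conditions of the box; each large
    [i] gives such a code. *)
Lemma code_points_dense (K : Type) (C : countType) (r : nat -> K -> C) :
  (forall k l, k <> l ->
    exists i0, forall i, (i0 <= i)%N -> r i k <> r i l) ->
  inf_dense (code_points r) setT.
Proof.
move=> rP x S finS; rewrite setTI.
have [i0 rI] := eventually_injective rP finS.
have [l lP] : {l : nat -> seq C & forall i,
    r i @` (S `&` [set k | x k = false]) = [set` l i]}.
  apply: (@choice _ _
    (fun i l => r i @` (S `&` [set k | x k = false]) = [set` l])).
  by move=> i; apply/finite_seqP/finite_image/finite_setIl.
apply/infiniteP; pose c i := choice.pickle (i0 + i, l (i0 + i)).
have cI : injective c.
  by move=> i j /(pcan_inj choice.pickleK)[] /addnI.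
have /card_eqPle[_ leT] : range c #= [set: nat].
  by apply: inj_card_eq => i j _ _; exact: cI.
apply: card_le_trans leT _; apply: subset_card_le => _ [i _ <-] k Sk.
rewrite /code_points choice.pickleK; have := lP (i0 + i).
move=> /seteqP[lP1 lP2]; case xk : (x k); last first.
  by apply/negbF/lP1; exists k.
apply/negP => /lP2[k' [Sk' /= xk'] rkk'].
suff k'k : k' = k by rewrite k'k xk in xk'.
by apply: (rI (i0 + i)) rkk'; rewrite ?leq_addr//; exact/mem_set.
Qed.

Lemma exists_dense_points :
  exists q : nat -> set nat * nat -> bool, inf_dense q setT.
Proof.
pose r i (t : set nat * nat) := ([seq j \in t.1 | j <- iota 0 i], t.2).
exists (code_points r); apply: code_points_dense => -[N n] [M m] NM.
have [nm|nm] := pselect (n = m); last by exists 0 => i _ [].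
have /existsNP[j Nj] : ~ forall j, (j \in N) = (j \in M).
  move=> NjM; apply: NM; rewrite nm; congr pair; apply/seteqP.
  by split=> j /mem_set jN; apply/set_mem; rewrite ?NjM// -NjM.
exists j.+1 => i ji [/eq_in_map rE _]; apply: Nj; apply: rE.
by rewrite mem_iota.
Qed.

(** * An ideal maximal among those that contain no box *)

Section MaximalIdeal.
Variables (K : Type) (q : nat -> K -> bool).

(** The empty set of sets qualifies, which makes the union of the empty chain
    harmless in Zorn's lemma. *)
Definition positive_ideal (J : set (set nat)) : Prop :=
  [/\ forall M N, J N -> M `<=` N -> J M,
      forall M N, J M -> J N -> J (M `|` N)
    & forall N, J N -> inf_dense q (~` N)].

(** The second conjunct is maximality in a usable form: [N] belongs to [J] as soon
    as the ideal generated by [J] and [N] is still positive. *)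
Lemma exists_maximal_ideal : inf_dense q setT ->
  exists J, positive_ideal J /\ forall N,
    (forall M, J M -> inf_dense q (~` (M `|` N))) -> J N.
Proof.
move=> qT; have [|J [[JS JU Jq] Jmax]] := @Zorn_bigcup _ positive_ideal.
  move=> F FP Ftot; split.
  - move=> M N [J FJ JN] MN; exists J => //.
    by have [JS _ _] := FP _ FJ; exact: JS MN.
  - move=> M N [J FJ JM] [J' FJ' J'N].
    have [JJ'|J'J] := Ftot _ _ FJ FJ'.
      exists J' => //; have [_ JU _] := FP _ FJ'; apply: JU => //; exact: JJ'.
    exists J => //; have [_ JU _] := FP _ FJ; apply: JU => //; exact: J'J.
  - by move=> N [J FJ JN]; have [_ _ Jq] := FP _ FJ; exact: Jq.
(* [M = set0] is allowed since it is not yet known that [J] is not empty. *)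
have ext N : (forall M, J M \/ M = set0 -> inf_dense q (~` (M `|` N))) -> J N.
  move=> Nq; pose J' := [set L | exists2 M, J M \/ M = set0 & L `<=` M `|` N].
  apply: contrapT => JN; apply: (Jmax J').
    split; first by move=> M JM; exists M; [left|exact: subsetUl].
    by move=> J'J; apply/JN/J'J; exists set0; [right|exact: subsetUr].
  split.
  - by move=> L L' [M JM L'M] LL'; exists M => //; exact: subset_trans L'M.
  - move=> L L' [M JM LM] [M' JM' LM']; exists (M `|` M').
      case: JM JM' => [JM|->] [JM'|->]; rewrite ?set0U ?setU0;
        [|by left|by left|by right].
      by left; exact: JU.
    by rewrite setUUl; exact: setUSS.
  - move=> L [M /Nq Mq LM] x S finS; apply: sub_infinite_set (Mq x S finS).
    by apply: setSI; exact: subsetC.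
have J0 : J set0.
  apply: ext => M [/Jq|->]; first by rewrite setU0.
  by rewrite setU0 setC0.
exists J; split=> // N NP; apply: ext => M [|->]; exact: NP.
Qed.
End MaximalIdeal.

(** * Anchoring an independent family *)

Section Anchoring.
Variables (q : nat -> set nat * nat -> bool) (J : set (set nat)).
Hypothesis Jpos : positive_ideal q J.
Hypothesis Jmax : forall N,
  (forall M, J M -> inf_dense q (~` (M `|` N))) -> J N.

(** In terms of subsets of [nat], this replaces [A_(N, n)] by
    [(A_(N, n) \ N) u {n}] when [N] is in [J] and [n] is not in [N]. *)
Definition anchor_points (n : nat) (t : set nat * nat) : bool :=
  if `[< J t.1 /\ ~ t.1 t.2 >]
  then (n != t.2) && ((n \in t.1) || q n t) else q n t.

Let Jsub M N : J N -> M `<=` N -> J M.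
Proof. by case: Jpos => H _ _; exact: H. Qed.

Let JU M N : J M -> J N -> J (M `|` N).
Proof. by case: Jpos => _ H _; exact: H. Qed.

Let Jco N : J N -> inf_dense q (~` N).
Proof. by case: Jpos => _ _; exact. Qed.

Lemma maximal_ideal_finite N : finite_set N -> J N.
Proof.
move=> finN; apply: Jmax => M /Jco Mq x S finS.
rewrite setCU -setIA (setIC (~` N)) setIA -setDE.
by apply: infinite_setD => //; exact: Mq.
Qed.

Lemma maximal_ideal_bigcup (T : choiceType) (S : set T) (F : T -> set nat) :
  finite_set S -> (forall t, S t -> J (F t)) -> J (\bigcup_(t in S) F t).
Proof.
move=> /finite_seqP[s ->] sF; rewrite bigcup_seq big_seq.
by apply: big_ind => //; exact: maximal_ideal_finite.
Qed.

(** The coordinate [(N, n)] is changed only on [N u {n}], which is in [J]; so only a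
    set in [J] is affected by finitely many coordinates. *)
Lemma anchor_points_small S : finite_set S ->
  exists2 N, J N & forall n, ~ N n -> forall t, S t -> anchor_points n t = q n t.
Proof.
move=> finS; pose good (t : set nat * nat) := J t.1 /\ ~ t.1 t.2.
exists (\bigcup_(t in S `&` good) (t.1 `|` [set t.2])).
  apply: maximal_ideal_bigcup => [|t [_ [Jt _]]]; first exact: finite_setIl.
  by apply: JU => //; exact/maximal_ideal_finite/finite_set1.
move=> n nN t St; rewrite /anchor_points; case: asboolP => // goodt.
have [nt1 nt2] : ~ t.1 n /\ n <> t.2.
  by split=> nt; apply: nN; exists t => //; [left|right].
by rewrite memNset//=; have /eqP-> := nt2.
Qed.

Lemma anchor_points_box S : finite_set S ->
  exists2 N, J N & forall x, box anchor_points x S `\` N = box q x S `\` N.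
Proof.
move=> /anchor_points_small[N JN NP]; exists N => // x.
by apply/seteqP; split=> n [nS nN]; split=> // t St;
  [rewrite -NP//|rewrite NP//]; exact: nS.
Qed.

(** By maximality of [J], it is enough that [X] meets no box in a set of [J]. If it
    met one in [L] in [J], fix one more coordinate [(L, n)], with [n] outside [L]
    and [(L, n)] not yet constrained, to the value 0: the smaller box lies in the
    new set of index [(L, n)], which is disjoint from [L], so [X] misses it. *)
Lemma anchor_points_dense_mem X : inf_dense anchor_points X -> J (~` X).
Proof.
move=> Xp; apply: Jmax => N JN x S finS fin.
have [M JM MP] := anchor_points_box finS.
have JXS : J (X `&` box anchor_points x S).
  apply: Jsub (JU (JU JM JN) (maximal_ideal_finite fin)) _ => n [Xn nS].
  have [Mn|nM] := pselect (M n); first by left; left.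
  have [Nn|nN] := pselect (N n); first by left; right.
  right; split; first by case.
  by have : (box anchor_points x S `\` M) n by []; rewrite MP => -[].
set L := X `&` box anchor_points x S in JXS.
(* The complement of [L] is infinite, while [S] constrains finitely many
   coordinates. *)
have [n [nL nS]] : exists n, ~ L n /\ ~ S (L, n).
  have /infinite_setN0[n [nL nS]] : infinite_set (~` L `\` (fun n => S (L, n))).
    apply: infinite_setD.
      by have := @Jco _ JXS xpredT set0 (finite_set0 _); rewrite box0 setIT.
    apply: (@finite_preimage _ _ S (pair L)) => //.
    by move=> a b _ _ [].
  by exists n.
pose y t := if `[< t = (L, n) >] then false else x t.
have finS' : finite_set (S `|` [set (L, n)]).
  by rewrite finite_setU; split=> //; exact: finite_set1.
have /infinite_setN0[m [Xm mS]] := Xp y _ finS'.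
have Lm : L m.
  split=> // t St; rewrite mS; last by left.
  by rewrite /y; case: asboolP => // tL; rewrite tL in St.
have := mS (L, n) (or_intror erefl); rewrite /y /anchor_points.
case: asboolP => [_|[]]; last by split.
case: asboolP => [_|/(_ erefl)//].
rewrite /= (mem_set Lm) andbT => /negbFE/eqP mn.
by rewrite -mn in nL.
Qed.

(** The coordinate [({n}, m)] separates [n] from [m], and for a dense [X] the
    coordinate [(~` X, n)] alone cuts out a box around [n] inside [X]. *)
Lemma anchor_points_submaximal : submaximal_points anchor_points.
Proof.
split.
- move=> x S finS; have [N JN NP] := anchor_points_box finS.
  rewrite setTI; apply: (@sub_infinite_set _ (box anchor_points x S `\` N)).
    by move=> ? [].
  by rewrite NP setDE setIC; exact: Jco.
- move=> n m nm; apply: contrapT => nmN.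
  have J1 : J [set n] by exact/maximal_ideal_finite/finite_set1.
  have := congr1 (fun f => f ([set n], m)) nm; rewrite /anchor_points/=.
  case: asboolP => [_|[]]; last by split=> // /esym.
  by rewrite eqxx (mem_set (erefl : [set n] n)) /= andbT => /eqP.
- move=> X /anchor_points_dense_mem JX n Xn.
  exists [set (~` X, n)]; first exact: finite_set1.
  move=> m /(_ _ erefl); rewrite /anchor_points/=.
  case: asboolP => [_|[]]; last by split.
  rewrite eqxx /= => /negbT; rewrite negb_and negbK => /orP[/eqP->//|].
  by rewrite negb_or => /andP[/negP mX _]; apply: contrapT => /mem_set.
Qed.

End Anchoring.

Lemma exists_submaximal_points :
  exists K, exists p : nat -> K -> bool, submaximal_points p.
Proof.
have [q qT] := exists_dense_points.
have [J [Jpos Jmax]] := exists_maximal_ideal qT.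
exists (set nat * nat)%type, (anchor_points q J).
exact: anchor_points_submaximal.
Qed.

(** * Least cardinals *)

(** Apply Zorn's lemma to the sets [F] of choice functions [g], with [g B] in [B]
    for all [B] in [G], any two of which differ at every [B]. If the values of a
    maximal [F] exhausted no [B], a function that picks a missing value in every
    [B] could be added. So they exhaust some [B0], and [g B0 |-> g B] injects [B0]
    in every other [B]. *)
Lemma exists_least_card (U : Type) (G : set (set U)) : G !=set0 ->
  exists2 A, G A & forall B, G B -> A #<= B.
Proof.
move=> [A0 GA0].
pose T := {B | G B} -> U.
pose P (F : set T) := (forall g B, F g -> sval B (g B)) /\
  forall B, {in F &, injective (fun g => g B)}.
have [C CP Ctot|F [[FB FI] Fmax]] := @Zorn_bigcup T P.
  split=> [g B [F CF Fg]|B f g]; first exact: (CP _ CF).1.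
  move=> /set_mem[F CF Ff] /set_mem[F' CF' F'g].
  have [FF'|F'F] := Ctot _ _ CF CF'.
    by apply: (CP _ CF').2; apply/mem_set => //; exact: FF'.
  by apply: (CP _ CF).2; apply/mem_set => //; exact: F'F.
have [B0 B0P] : exists B : {B | G B}, sval B `<=` [set g B | g in F].
  apply: contrapT => /forallNP FN.
  have [g gP] : {g : T & forall B, sval B (g B) /\ ~ [set h B | h in F] (g B)}.
    apply: (@choice _ _ (fun B u => sval B u /\ ~ [set h B | h in F] u)) => B.
    apply: contrapT => /forallNP NB; apply: (FN B) => u Bu.
    by apply: contrapT => nF; apply: (NB u).
  have gF : ~ F g by move=> Fg; apply: (gP (exist _ A0 GA0)).2; exists g.
  apply: (Fmax (F `|` [set g])).
    by split=> [h|/(_ g)]; [left|move=> gN; apply/gF/gN; right].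
  split=> [h B [/FB//|->]|B h h']; first exact: (gP B).1.
  move=> /set_mem[Fh|->] /set_mem[Fh'|->] //.
  - by apply: FI; exact/mem_set.
  - by move=> hg; case: (gP B).2; exists h.
  - by move=> hg; case: (gP B).2; exists h'.
exists (sval B0); first exact: svalP B0.
move=> B GB; apply: card_le_trans (subset_card_le B0P) _.
rewrite (card_le_eql (inj_card_eq (FI B0))).
rewrite -(card_le_eql (inj_card_eq (FI (exist _ B GB)))).
by apply: subset_card_le => _ [g Fg <-]; exact: (FB g (exist _ B GB)).
Qed.

(** * Families of sets as sequences of points *)

Section Families.
Variables (K : Type) (p : nat -> K -> bool).

Definition coordinate_set (k : K) : set nat := [set n | ~~ p n k].

Let a := coordinate_set.
Let A : set (set nat) := range a.

Lemma signed_coordinate_set k b n : signed_set (a k) b n <-> p n k = b.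
Proof.
rewrite /a /coordinate_set /signed_set; case: b => /=.
  by split=> [/negP|->//]; rewrite negbK.
by split=> [/negbTE|->].
Qed.

(** Injectivity of the family keeps the set of constrained indices finite here, and
    makes the sign of a set well defined in the converse [box_bool_comb]. *)
Lemma bool_comb_box : injective a -> forall h, FF A h ->
  exists x S, finite_set S /\ bool_comb h = box p x S.
Proof.
move=> aI h hA; exists (fun k => odflt false h.[? a k]%fmap).
exists (a @^-1` [set` domf h]); split.
  by apply: finite_preimage => // k l _ _; exact: aI.
apply/seteqP; split=> n hn.
  move=> k /= kh; apply/signed_coordinate_set; apply: hn.
  by rewrite in_fnd.
move=> B b hB; have Bh : B \in domf h by rewrite -fndSome hB.
have [k _ kB] := hA _ Bh; rewrite -kB; apply/signed_coordinate_set.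
by rewrite hn ?kB ?hB//=; rewrite kB.
Qed.

Lemma box_bool_comb : injective a -> forall x S, finite_set S ->
  exists2 h, FF A h & bool_comb h = box p x S.
Proof.
move=> aI x S finS; pose y (B : set nat) := `[< exists2 k, a k = B & x k >].
have ya k : y (a k) = x k.
  by apply/asboolP/idP => [[l /aI->]|]; [|exists k].
have /finite_fsetP[D DE] : finite_set (a @` S) by exact: finite_image.
exists [fmap B : D => y (val B)].
  by move=> B BD; have : [set` D] B by []; rewrite -DE => -[k _ <-]; exists k.
apply/seteqP; split=> n hn.
  move=> k Sk; have aD : a k \in D.
    by have : (a @` S) (a k) by [exists k]; rewrite DE.
  by apply/signed_coordinate_set/hn; rewrite in_fnd ffunE /= ya.
move=> B b; case: fndP => // BD [<-]; rewrite ffunE /=.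
have : [set` D] B by []; rewrite -DE => -[k Sk kB]; rewrite -kB ya.
by apply/signed_coordinate_set; exact: hn.
Qed.

Lemma family_denseP : injective a -> forall X, family_dense A X <-> inf_dense p X.
Proof.
move=> aI X; split=> Xd.
  by move=> x S finS; have [h hA <-] := box_bool_comb aI x finS; exact: Xd.
by move=> h /(bool_comb_box aI)[x [S [finS ->]]]; exact: Xd.
Qed.

Lemma independentP : injective a -> independent A <-> inf_dense p setT.
Proof.
move=> aI; rewrite -family_denseP//.
by split=> AT h hA; [rewrite setTI|have := AT h hA; rewrite setTI]; [exact: AT|].
Qed.

Lemma separates_pointsP : separates_points A <-> injective p.
Proof.
split=> [sep n m nm|pI n m nm].
  apply: contrapT => /sep[_ [k _ <-]]; rewrite /a /coordinate_set/= nm.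
  by case=> -[].
have /existsNP[k pk] : ~ forall k, p n k = p m k.
  by move=> /funext/pI.
exists (a k); first by exists k.
rewrite /a /coordinate_set /=; move: pk.
by case: (p n k) (p m k) => -[]// _; [right|left]; split.
Qed.

(** An anchoring Boolean combination is only almost included in [X]; since the
    points are distinct, constraining finitely many more coordinates removes the
    finite remainder, which does not contain [n]. *)
Lemma anchored_independentP : injective a ->
  anchored_independent A /\ separates_points A <-> submaximal_points p.
Proof.
move=> aI; rewrite separates_pointsP /anchored_independent independentP//.
split=> [[[pT anch] pI]|[pT pI subm]]; split=> //.
  move=> X Xp n Xn; have [|h [hA hn hX]] := anch X _ n Xn; first exact/family_denseP.
  have [x [S [finS hE]]] := bool_comb_box aI hA.
  rewrite hE in hn hX.
  have [|S' finS' S'P] := separate_finite pI hX (n := n); first by case.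
  exists (S `|` S'); first by rewrite finite_setU.
  rewrite boxU (box_center hn) => m [mS /S'P]; apply: contra_notP => mX.
  by split.
split=> // X /(family_denseP aI) Xp n Xn.
have [S finS SX] := subm X Xp n Xn.
have [h hA hE] := box_bool_comb aI (p n) finS.
exists h; split=> //; rewrite /almost_subset hE //.
rewrite (_ : _ `\` _ = set0)//.
by apply/seteqP; split=> // m [/SX].
Qed.

(** Two indices with the same set could not be given different signs. *)
Lemma coordinate_set_inj : inf_dense p setT -> injective a.
Proof.
move=> pT k l kl; apply: contrapT => klN.
have /infinite_setN0[n [_ nS]] :=
  pT (fun j => `[< j = k >]) [set k; l] (finite_set2 _ _).
have := nS k (or_introl erefl); have := nS l (or_intror erefl).
have lk : l <> k by move=> /esym.
rewrite (asboolT erefl) (asboolF lk).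
move=> nl nk; have : a l n by rewrite /a /coordinate_set /= nl.
by rewrite -kl /a /coordinate_set /= nk.
Qed.

End Families.

Lemma anchored_family_points (K : Type) :
  (exists A, [/\ anchored_independent A, separates_points A & A #= [set: K]]) <->
  exists p : nat -> K -> bool, submaximal_points p.
Proof.
split=> [[A [Aanch Asep AK]]|[p pP]].
  have /card_bijP[f fbij] : [set: K] #= A by rewrite card_eq_sym.
  pose b k : set nat := val (f (to_setT k)).
  exists (fun n k => `[< ~ b k n >]).
  have bE : coordinate_set (fun n k => `[< ~ b k n >]) = b.
    apply/funext => k; apply/seteqP; rewrite /coordinate_set.
    by split=> n /=; rewrite -asbool_neg notK => /asboolP.
  have bI : injective b.
    by move=> k l /val_inj/(bij_inj fbij)/(congr1 val).
  apply/anchored_independentP; rewrite bE//.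
  suff -> : range b = A by [].
  apply/seteqP; split=> [_ [k _ <-]|B AB]; first exact: set_valP.
  have [g gK fK] := fbij; exists (val (g (SigSub (mem_set AB)))) => //.
  rewrite /b (_ : to_setT _ = g (SigSub (mem_set AB))) ?fK//.
  exact: val_inj.
have pI : injective (coordinate_set p) by apply: coordinate_set_inj; case: pP.
have [Aanch Asep] := (anchored_independentP pI).2 pP.
exists (range (coordinate_set p)); split=> //.
by apply: inj_card_eq => k l _ _; exact: pI.
Qed.

(** * The subspace topology in terms of boxes *)

Local Notation point_of D := (fun d : set_type D => set_val d).

Lemma nbhs_cubeP (K : Type) (x : {ptws K -> bool}) (U : set {ptws K -> bool}) :
  nbhs x U <-> exists2 S, finite_set S & box id x S `<=` U.
Proof.
pose cyl := filter_from (@finite_set K) (box id x).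
have cylF : Filter cyl.
  apply: filter_from_filter; first by exists set0.
  move=> S S' finS finS'; exists (S `|` S'); first by rewrite finite_setU.
  by rewrite boxU.
split=> [|[S finS SU]].
  suff : cyl --> x by apply.
  apply/cvg_sup => k V [_ [[B oB <-]] /= Bx BV].
  exists [set k]; first exact: finite_set1.
  by move=> y /(_ k erefl) yx; apply: BV; rewrite /= yx.
apply: filterS SU _; have /(@finite_fsetP {classic K})[D ->] := finS.
suff : nbhs x (\bigcap_(k in [set` D]) [set y : {ptws K -> bool} | y k = x k]).
  by apply: filterS => y yP k /yP.
apply: filter_bigI => k _; have /cvg_sup/(_ k) : nbhs x --> x by exact: cvg_id.
apply; exists [set y | y k = x k]; split=> //.
by exists [set x k] => //; exact: discrete_open.
Qed.

Lemma nbhs_subcubeP (K : Type) (D : set {ptws K -> bool}) (d : D) (U : set D) :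
  nbhs d U <->
  exists2 S, finite_set S & box (point_of D) (set_val d) S `<=` U.
Proof.
split=> [[_ [[B oB <-]] /= Bd BU]|[S finS SU]].
  have /nbhs_cubeP[S finS SB] : nbhs (set_val d) B by exact: open_nbhs_nbhs.
  by exists S => // e eS; apply: BU; exact: SB.
apply: filterS SU _.
have dS : nbhs (set_val d : {ptws K -> bool}) (box id (set_val d) S).
  by apply/nbhs_cubeP; exists S.
exact: (@initial_continuous D {ptws K -> bool} set_val d _ dS).
Qed.

Lemma dense_subcubeP (K : Type) (D : set {ptws K -> bool}) :
  dense D <-> forall x S, finite_set S -> exists2 d, D d & box id x S d.
Proof.
split=> [dD x S finS|dD O [x Ox] oO].
  pose O : set {ptws K -> bool} := box id x S.
  have xO : nbhs (x : {ptws K -> bool}) O by apply/nbhs_cubeP; exists S.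
  have [] := dD O°; first by exists x.
    exact: open_interior.
  by move=> d [/interior_subset]; exists d.
have /nbhs_cubeP[S finS SO] : nbhs x O by exact: open_nbhs_nbhs.
by have [d Dd /SO] := dD x S finS; exists d.
Qed.

(** * Enumerations of submaximal subspaces *)

Lemma submaximal_points_subspace (K : Type) (p : nat -> K -> bool) :
  submaximal_points p -> has_countable_dense_submaximal K.
Proof.
move=> [pT pI subm]; exists (range p).
pose D : set {ptws K -> bool} := range p.
pose e n : D := SigSub (mem_set (imageT p n)).
have eP (d : D) : exists n, d = e n.
  by have [n _ nd] := set_valP d; exists n; apply: val_inj.
have boxe x S n : box (point_of D) x S (e n) <-> box p x S n by [].
split.
- exact: card_image_le.
- apply/dense_subcubeP => x S finS.
  have /infinite_setN0[n [_ nS]] := pT x S finS.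
  by exists (p n) => //; exists n.
- rewrite open_hausdorff => c d cdN.
  have cd : c <> d by move=> cd; rewrite cd eqxx in cdN.
  have /existsNP[k ck] : ~ forall k, set_val c k = set_val d k.
    by move=> /funext/val_inj.
  pose O (b : bool) : set D := [set y | set_val y k = b].
  have oO b : open (O b).
    rewrite openE => y yb; apply/nbhs_subcubeP; exists [set k].
      exact: finite_set1.
    by move=> z /(_ k erefl) zy; rewrite /O /= zy.
  exists (O (set_val c k), O (set_val d k)); first by split; exact/mem_set.
  split; [exact: oO|exact: oO|apply/eqP; rewrite -subset0].
  by move=> y [/= yc yd]; apply: ck; rewrite -yc -yd.
- apply/seteqP; split=> // d [_ [V /nbhs_subcubeP[S finS SV]]].
  rewrite setIT => Vd.
  have [m dm] := eP d; rewrite dm in SV Vd.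
  apply: (pT (p m) S finS); rewrite setTI.
  apply: (@sub_finite_set _ _ [set m]); last exact: finite_set1.
  move=> n nS; have : V (e n) by exact: SV.
  rewrite Vd => /(congr1 val) nm.
  exact: pI.
- move=> E dE; rewrite openE => d Ed; apply/nbhs_subcubeP.
  have [n dn] := eP d; rewrite dn in Ed *.
  have [|S finS SE] := subm [set n | E (e n)] _ n Ed; last first.
    by exists S => // y; have [m ->] := eP y => /boxe/SE.
  (* If [E] met a box in finitely many points, a smaller box would miss [E]. *)
  move=> x S finS fin.
  have [m [mS mE]] : exists m, box p x S m /\ ~ E (e m).
    have /infinite_setN0[m [mS mE]] := infinite_setD (pT x S finS) fin.
    by exists m; split; [case: mS|move=> Em; apply: mE; split=> //; case: mS].
  have [|S' finS' S'P] := separate_finite pI fin (n := m); first by case.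
  pose O : set D := box (point_of D) (p m) (S `|` S').
  have Om : O° !=set0.
    exists (e m); apply/nbhs_subcubeP; exists (S `|` S') => //.
    by rewrite finite_setU.
  have [y [yO yE]] := dE _ Om (@open_interior _ O).
  have [l yl] := eP y; rewrite yl in yO yE.
  move/interior_subset/boxe: yO; rewrite boxU (box_center mS) => -[lS /S'P].
  by apply.
Qed.

(** If a box met [D] in finitely many points, one of them could be isolated from the
    others by fixing finitely many more coordinates. *)
Lemma crowded_dense_infinite (K : Type) (D : set {ptws K -> bool}) :
  dense D -> crowded D -> inf_dense (point_of D) setT.
Proof.
move=> /dense_subcubeP dD cD x S finS; rewrite setTI => fin.
have [d0 Dd0 d0S] := dD x S finS.
pose d : D := SigSub (mem_set Dd0).
have dS : box (point_of D) x S d by [].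
have [|||T finT TP] := @separate_finite _ _ (point_of D) d
    (box (point_of D) x S `\ d).
- exact: val_inj.
- exact: finite_setD.
- by move=> [_ /(_ erefl)].
suff : isolated [set: D] d by rewrite cD.
split; first exact/mem_set.
exists (box (point_of D) (set_val d) (S `|` T)).
  by apply/nbhs_subcubeP; exists (S `|` T); rewrite ?finite_setU.
rewrite setIT boxU; apply/seteqP; split=> [e [eS eT]|_ ->]; last by split.
apply: contrapT => ed; apply: (TP e eT); split=> //.
by rewrite -(box_center dS).
Qed.

(** [D] is countable and, by [crowded_dense_infinite], infinite; the sequence is a
    bijective enumeration of it. *)
Lemma subspace_submaximal_points (K : Type) :
  has_countable_dense_submaximal K ->
  exists p : nat -> K -> bool, submaximal_points p.
Proof.
move=> [D [ctD dD _ cD sD]].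
have Dinf := crowded_dense_infinite dD cD.
have /card_bijP[f [g fK gK]] : [set: nat] #= D.
  apply/card_eqPle; split=> //.
  apply/infiniteP => finD; apply: (Dinf xpredT set0 (finite_set0 _)).
  rewrite box0 setTI; apply: card_le_finite finD.
  by rewrite (card_le_eql (card_setT D)).
pose e n : D := f (to_setT n).
pose i (d : D) : nat := val (g d).
have eK : cancel e i by move=> n; rewrite /i /e fK.
have iK : cancel i e.
  by move=> d; rewrite /e /i (_ : to_setT _ = g d) ?gK//; exact: val_inj.
exists (fun n => set_val (e n)); split.
- move=> x S finS fin; apply: (Dinf x S finS).
  apply: sub_finite_set (finite_image e fin) => d [_ dS].
  by exists (i d); rewrite ?iK//; split=> // k Sk; rewrite iK; exact: dS.
- by move=> n m /val_inj/(can_inj eK).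
- move=> X Xd n Xn; pose E : set D := [set d | X (i d)].
  have oE : open E.
    apply: sD => O [d Od] oO.
    have /nbhs_subcubeP[S finS SO] : nbhs d O by exact: open_nbhs_nbhs.
    have /infinite_setN0[m [Xm mS]] := Xd (set_val d) S finS.
    by exists (e m); split; [exact: SO|rewrite /E /= eK].
  have /nbhs_subcubeP[S finS SE] : nbhs (e n) E.
    by apply: open_nbhs_nbhs; split=> //; rewrite /E/= eK.
  by exists S => // m mS; rewrite -(eK m); exact: (SE (e m)).
Qed.

Lemma submaximal_pointsP (K : Type) :
  (exists p : nat -> K -> bool, submaximal_points p) <->
  has_countable_dense_submaximal K.
Proof.
split=> [[p]|]; first exact: submaximal_points_subspace.
exact: subspace_submaximal_points.
Qed.

Theorem proposition2p5 :
  exists kappa : Type,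
    is_i_a kappa /\ least_cardinal has_countable_dense_submaximal kappa.
Proof.
pose G := [set A | anchored_independent A /\ separates_points A].
have [|A [Aanch Asep] Amin] := @exists_least_card _ G.
  have [K /anchored_family_points[A [Aanch Asep _]]] := exists_submaximal_points.
  by exists A.
have PA : exists B,
    [/\ anchored_independent B, separates_points B & B #= [set: A]].
  by exists A; split=> //; exact: card_setT_sym.
have leA (L : Type) :
    (exists B, [/\ anchored_independent B, separates_points B & B #= [set: L]]) ->
    [set: A] #<= [set: L].
  move=> [B [Banch Bsep BL]].
  rewrite (card_le_eql (card_setT A)) -(card_le_eqr BL).
  exact: Amin.
exists A; split; split=> //.
  exact/submaximal_pointsP/anchored_family_points.
by move=> L /submaximal_pointsP/anchored_family_points; exact: leA.
Qed.
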